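(* For every cubic graph $G$, $\nu_2(G) \geq \frac{16}{17}\cdot \frac{|V(G)| + 2\cdot \nu_3(G)}{4}$.
   Context: Graphs are finite, without loops, possibly with multiple edges; a graph is cubic if every vertex has degree $3$. For $k\geq 1$, $\nu_k(G)$ is the maximum number of edges of a $k$-edge-colorable subgraph of $G$. *)

(* Defs.v *)
From mathcomp Require Import all_boot.
Set Implicit Arguments. Unset Strict Implicit. Unset Printing Implicit Defensive.

(* A finite multigraph (parallel edges allowed) on vertex type V with edge type E:
   each edge e has two endpoints [src e] and [tgt e] (orientation irrelevant). *)
Section Multigraph.
Variables (V E : finType) (src tgt : E -> V).

Definition loopless : bool := [forall e, src e != tgt e].

Definition incident (v : V) (e : E) : bool := (src e == v) || (tgt e == v).

(* degree (in a loopless graph each incident edge counts once) *)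
Definition degree (v : V) : nat := #|[set e | incident v e]|.

Definition cubic : bool := [forall v, degree v == 3].

Definition adjacent (e f : E) : bool :=
  [|| incident (src e) f | incident (tgt e) f].

Definition edge_colorable (k : nat) (F : {set E}) : bool :=
  [exists c : {ffun E -> 'I_k},
     [forall e in F, forall f in F, ((e != f) && adjacent e f) ==> (c e != c f)]].

Definition nu (k : nat) : nat :=
  \max_(F : {set E} | edge_colorable k F) #|F|.

End Multigraph.

(* Main.v *)
Require Import Defs.
From mathcomp Require Import all_boot zify.

Set Implicit Arguments. Unset Strict Implicit. Unset Printing Implicit Defensive.

(** The bound is a combination of [3 nu_2 >= 2 nu_3] (drop each of the three
colour classes in turn and add up) and [5 nu_2 >= 4 |V|].

For the latter, cover the vertices by disjoint paths and even cycles; alternating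
colours along them gives [nu_2 >= |V| - #paths], so it suffices to find a cover
with [5 #paths <= |V|].  Take a cover with fewest paths and, among those, fewest
isolated vertices, and discharge: every vertex has charge 1, every path needs 5,
and path ends collect charge along the uncovered edges leaving their component.
By minimality, ends of distinct paths are not adjacent, a vertex next to an end
of another path cannot become an end of its own path by rerouting it, and two
consecutive vertices of a component cannot both be heavily charged; this bounds
the charge a component loses. *)

(** * Covers by vertex-disjoint paths and even cycles *)

Section Covers.
Variables (V : finType) (mult : V -> V -> nat).
Hypothesis multC : forall x y, mult x y = mult y x.
Hypothesis multxx : forall x, mult x x = 0.
Hypothesis mult_sum : forall x, \sum_y mult x y = 3.

Definition adj : rel V := fun x y => 0 < mult x y.

(* Two vertices form a cycle when they are joined by a double edge. *)
Definition even_cycle (s : seq V) :=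
  [&& cycle adj s, ~~ odd (size s)
    & if s is [:: x; y] then 1 < mult x y else true].

(* A component is a cycle if its flag is [true], a path otherwise; an isolated
   vertex is a path of size 1. *)
Definition valid (c : bool * seq V) :=
  (c.2 != [::]) && (if c.1 then even_cycle c.2 else sorted adj c.2).

(* The exchanges below never create an isolated vertex, so the extra unit for one
   acts as a tie-break among covers with the same number of paths. *)
Definition cost (c : bool * seq V) :=
  if c.1 then 0 else if size c.2 == 1 then 3 else 2.

Definition vertices (C : seq (bool * seq V)) := flatten (map snd C).

Definition is_cover C := all valid C && perm_eq (vertices C) (enum V).

Definition total_cost C := \sum_(c <- C) cost c.

Lemma adjC : symmetric adj.
Proof. by move=> x y; rewrite /adj multC. Qed.

Lemma head_rev (s : seq V) x : head x (rev s) = last x s.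
Proof. by case/lastP: s => // s y; rewrite rev_rcons last_rcons. Qed.

Lemma sorted_rev s : sorted adj (rev s) = sorted adj s.
Proof. by rewrite rev_sorted; apply: eq_sorted => x y; rewrite adjC. Qed.

Lemma sorted_join s x y t :
  sorted adj (rcons s x) -> path adj y t -> adj x y ->
  sorted adj (rcons s x ++ y :: t).
Proof.
case: s => [|z s] /=; first by move=> _ -> ->.
by move=> ps pt axy; rewrite cat_path ps last_rcons /= axy pt.
Qed.

Lemma sorted_catl s t : sorted adj (s ++ t) -> sorted adj s.
Proof. by case/cat_sorted2. Qed.

Lemma sorted_catr s t : sorted adj (s ++ t) -> sorted adj t.
Proof. by case/cat_sorted2. Qed.

(** * Exchanges in a cover of minimal cost *)

Section Minimal.
Variable C : seq (bool * seq V).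
Hypothesis Ccov : is_cover C.
Hypothesis Cmin : forall C', is_cover C' -> total_cost C <= total_cost C'.

Lemma exchange L L' R :
  perm_eq C (L ++ R) -> all valid L' -> perm_eq (vertices L') (vertices L) ->
  total_cost L <= total_cost L'.
Proof.
move=> pC okL' pL; have /andP[okC pV] := Ccov.
have: is_cover (L' ++ R).
  move: okC; rewrite /is_cover (perm_all _ pC) !all_cat okL' => /andP[_ ->] /=.
  rewrite -(permPr pV) /vertices map_cat flatten_cat.
  rewrite perm_sym (permPl (perm_flatten (perm_map _ pC))) map_cat flatten_cat.
  by rewrite perm_cat2r perm_sym.
by move/Cmin; rewrite /total_cost (perm_big _ pC) !big_cat leq_add2r.
Qed.

Lemma exchange1 P L' :
  P \in C -> all valid L' -> perm_eq (vertices L') P.2 -> cost P <= total_cost L'.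
Proof.
move=> /perm_to_rem pC okL' pL.
have := @exchange [:: P] L' _ pC okL'.
by rewrite /total_cost big_seq1 /vertices /= cats0; apply.
Qed.

Lemma rem_neq P Q : Q \in C -> P != Q -> P \in C -> Q \in rem P C.
Proof.
by move=> QC nPQ /perm_to_rem/perm_mem/(_ Q); rewrite QC inE eq_sym (negPf nPQ).
Qed.

Lemma exchange2 P Q L' :
  P \in C -> Q \in C -> P != Q -> all valid L' ->
  perm_eq (vertices L') (P.2 ++ Q.2) -> cost P + cost Q <= total_cost L'.
Proof.
move=> PC QC nPQ okL' pL.
have /perm_to_rem pQ := rem_neq QC nPQ PC.
have pC : perm_eq C ([:: P; Q] ++ rem Q (rem P C)).
  by rewrite (permPl (perm_to_rem PC)) /= perm_cons.
have := exchange pC okL'.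
by rewrite /total_cost big_cons big_seq1 /vertices /= cats0; apply.
Qed.

Lemma exchange3 P Q S L' :
  P \in C -> Q \in C -> S \in C -> P != Q -> P != S -> Q != S -> all valid L' ->
  perm_eq (vertices L') (P.2 ++ Q.2 ++ S.2) ->
  cost P + cost Q + cost S <= total_cost L'.
Proof.
move=> PC QC SC nPQ nPS nQS okL' pL.
have QR := rem_neq QC nPQ PC; have SR := rem_neq SC nPS PC.
have SR' : S \in rem Q (rem P C).
  have /perm_mem/(_ S) := perm_to_rem QR.
  by rewrite SR inE eq_sym (negPf nQS).
have pC : perm_eq C ([:: P; Q; S] ++ rem S (rem Q (rem P C))).
  rewrite (permPl (perm_to_rem PC)) /= perm_cons.
  rewrite (permPl (perm_to_rem QR)) /= perm_cons.
  exact: perm_to_rem SR'.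
have := exchange pC okL'.
by rewrite /total_cost !big_cons big_nil addn0 addnA /vertices /= cats0; apply.
Qed.

Lemma comp_valid c : c \in C -> valid c.
Proof. by have /andP[/allP okC _] := Ccov; apply: okC. Qed.

Lemma vertices_uniq : uniq (vertices C).
Proof. by have /andP[_ pV] := Ccov; rewrite (perm_uniq pV) enum_uniq. Qed.

Lemma comp_uniq c : c \in C -> uniq c.2.
Proof.
move=> /perm_to_rem pC; have := vertices_uniq.
rewrite /vertices (perm_uniq (perm_flatten (perm_map _ pC))) /= cat_uniq.
by case/and3P.
Qed.

Lemma comp_disjoint c d v :
  c \in C -> d \in C -> v \in c.2 -> v \in d.2 -> c = d.
Proof.
move=> cC dC vc vd; apply/eqP; apply: contraT => ncd.
have dR := rem_neq dC ncd cC.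
have := vertices_uniq; rewrite /vertices.
rewrite (perm_uniq (perm_flatten (perm_map _ (perm_to_rem cC)))) /= cat_uniq.
case/and3P=> _ /hasPn nvc _.
have /nvc/negP[] // : v \in flatten [seq d.2 | d <- rem c C].
by apply/flattenP; exists d.2 => //; apply: map_f.
Qed.

(** The default is never reached, since every vertex is covered. *)
Definition comp_of v := nth (true, [::]) C (find (fun c => v \in c.2) C).

Lemma comp_ofP v : (comp_of v \in C) && (v \in (comp_of v).2).
Proof.
have hv : has (fun c => v \in c.2) C.
  have /andP[_ /perm_mem/(_ v)] := Ccov; rewrite mem_enum inE.
  by case/flattenP=> s /mapP[c cC ->] vc; apply/hasP; exists c.
by rewrite mem_nth -?has_find //= (nth_find _ hv).
Qed.

Lemma comp_of_in v : comp_of v \in C. Proof. by case/andP: (comp_ofP v). Qed.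

Lemma mem_comp v c : c \in C -> (v \in c.2) = (comp_of v == c).
Proof.
move=> cC; have /andP[cv vv] := comp_ofP v.
apply/idP/eqP => [vc|<-//]; exact: comp_disjoint vv vc.
Qed.

Lemma sum_comps (f : bool * seq V -> V -> nat) :
  \sum_(c <- C) \sum_(v <- c.2) f c v = \sum_v f (comp_of v) v.
Proof.
have /andP[_ pV] := Ccov.
rewrite -(big_enum _ _ _ (fun v => f (comp_of v) v)) -(perm_big _ pV) /=.
rewrite /vertices big_flatten big_map; apply: eq_big_seq => c cC.
by apply: eq_big_seq => v; rewrite mem_comp // => /eqP->.
Qed.

(** The path from [x] may be any Hamiltonian path on the vertices of [c], not just the listed one:
    rerouting inside a component is free. *)
Definition endof (c : bool * seq V) x :=
  [/\ c \in C, ~~ c.1 & exists2 s, perm_eq (x :: s) c.2 & path adj x s].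

Lemma path_cost c : ~~ c.1 -> 2 <= cost c.
Proof. by rewrite /cost => /negPf->; case: ifP. Qed.

(** Joining the two paths along the edge would leave one path of cost 2, against at least 4
    before. *)
Lemma no_merge P Q x y : endof P x -> endof Q y -> P != Q -> adj x y = false.
Proof.
move=> [PC Pp [s pP ps]] [QC Qp [t pQ pt]] nPQ; apply/negP => axy.
have := @exchange2 P Q [:: (false, rev (x :: s) ++ y :: t)] PC QC nPQ.
rewrite /total_cost big_seq1 {3}/cost /valid /vertices /= cats0 andbT.
have -> : size (rev (x :: s) ++ y :: t) == 1 = false.
  by rewrite size_cat size_rev /= addnS.
have := path_cost Pp; have := path_cost Qp => cQ cP H.
suff : cost P + cost Q <= 2 by move: cP cQ; clear; lia.
apply: H; last by apply: perm_cat => //; rewrite perm_rev.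
rewrite rev_cons sorted_join // -?rev_cons ?sorted_rev //.
by rewrite -size_eq0 size_cat /= addnS.
Qed.

(* The path [Q] is cut between [u] and [v], and the halves extended by [P] and
   [P']: three paths become two. *)
Lemma no_split_merge P P' Q x y s u v t :
  endof P x -> endof P' y -> P != P' -> P != Q -> P' != Q ->
  Q \in C -> ~~ Q.1 -> perm_eq (rcons s u ++ v :: t) Q.2 ->
  sorted adj (rcons s u ++ v :: t) -> adj x u -> adj y v -> False.
Proof.
move=> [PC Pp [a pP pa]] [PC' Pp' [b pP' pb]] n1 n2 n3 QC Qp pQ sQ axu ayv.
pose L' := [:: (false, rcons s u ++ x :: a); (false, rev (y :: b) ++ v :: t)].
have := @exchange3 P P' Q L' PC PC' QC n1 n2 n3.
have := path_cost Pp; have := path_cost Pp'; have := path_cost Qp => c1 c2 c3.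
(* Both new paths have at least two vertices, so neither pays for isolation. *)
have -> : total_cost L' = 4.
  by rewrite /total_cost !big_cons big_nil /cost /= !size_cat size_rev size_rcons !addnS.
move=> H; suff : cost P + cost P' + cost Q <= 4 by move: c1 c2 c3; clear; lia.
apply: H.
  rewrite /= /valid /= -!size_eq0 !size_cat size_rev size_rcons !addnS /= andbT.
  rewrite sorted_join ?(sorted_catl sQ) //=; last by rewrite adjC.
  rewrite rev_cons sorted_join // -?rev_cons ?sorted_rev //.
  by have := sorted_catr sQ.
rewrite /vertices /= cats0.
have e1 : perm_eq (P.2 ++ P'.2 ++ Q.2) ((x :: a) ++ (y :: b) ++ (rcons s u ++ v :: t)).
  by rewrite perm_sym; do !apply: perm_cat.
rewrite (permPr e1); apply/permP => p.
rewrite !count_cat count_rev /=; clear; lia.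
Qed.

(** Meant for a cycle [Q] cut open between [u] and [v]: attaching [P] at [u] and [P'] at [v] yields
    a single path of cost 2, whereas [P] and [P'] alone cost at least 4. *)
Lemma no_open_cycle P P' Q x y v s u :
  endof P x -> endof P' y -> P != P' -> P != Q -> P' != Q ->
  Q \in C -> perm_eq (rcons (v :: s) u) Q.2 -> sorted adj (rcons (v :: s) u) ->
  adj x u -> adj y v -> False.
Proof.
move=> [PC Pp [a pP pa]] [PC' Pp' [b pP' pb]] n1 n2 n3 QC pQ sQ axu ayv.
pose L' := [:: (false, rev (y :: b) ++ (rcons (v :: s) u ++ x :: a))].
have := @exchange3 P P' Q L' PC PC' QC n1 n2 n3.
have := path_cost Pp; have := path_cost Pp' => c1 c2.
have -> : total_cost L' = 2.
  by rewrite /total_cost !big_cons big_nil /cost /= !size_cat size_rev /= addnS.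
move=> H; suff : cost P + cost P' + cost Q <= 2 by move: c1 c2; clear; lia.
apply: H.
  rewrite /= /valid /= -!size_eq0 !size_cat size_rev /= andbT.
  rewrite rev_cons sorted_join // -?rev_cons ?sorted_rev //.
  by have := @sorted_join (v :: s) u x a; apply; rewrite // adjC.
rewrite /vertices /= cats0.
have e1 : perm_eq (P.2 ++ P'.2 ++ Q.2) ((x :: a) ++ (y :: b) ++ rcons (v :: s) u).
  by rewrite perm_sym; do !apply: perm_cat.
rewrite (permPr e1); apply/permP => p.
rewrite !count_cat count_rev /= !count_cat /=; clear; lia.
Qed.

Lemma no_close Q s :
  Q \in C -> ~~ Q.1 -> perm_eq s Q.2 -> even_cycle s -> False.
Proof.
move=> QC Qp pQ cs; have := @exchange1 Q [:: (true, s)] QC.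
have := path_cost Qp; rewrite /total_cost big_seq1 {3}/cost /= => c1 H.
suff: cost Q <= 0 by move: c1; clear; lia.
apply: H; last by rewrite /vertices /= cats0.
rewrite /valid /= cs !andbT -size_eq0 (perm_size pQ) size_eq0.
by have /andP[] := comp_valid QC.
Qed.

(** Here the tie-break acts: cutting [Q] after [u] and appending [z] to [u] keeps the number of
    paths, but removes an isolated vertex unless [t] is a new one. *)
Lemma isolated_split z Q s u t :
  (false, [:: z]) \in C -> Q \in C -> (false, [:: z]) != Q -> ~~ Q.1 ->
  perm_eq (rcons s u ++ t) Q.2 -> sorted adj (rcons s u ++ t) -> adj z u ->
  size t <= 1.
Proof.
move=> zC QC nzQ Qp pQ sQ azu; rewrite leqNgt; apply/negP => lt.
pose L' := [:: (false, rcons s u ++ [:: z]); (false, t)].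
have := @exchange2 _ _ L' zC QC nzQ.
have c1 := path_cost Qp.
have -> : total_cost L' = 4.
  rewrite /total_cost !big_cons big_nil /cost /= !size_cat size_rcons /= addn1.
  by case: ifP => // /eqP e; rewrite e in lt.
rewrite {1}/cost /= => H; suff: 3 + cost Q <= 4 by move: c1; clear; lia.
apply: H.
  rewrite /= /valid /= -!size_eq0 !size_cat size_rcons /= andbT.
  rewrite sorted_join ?(sorted_catl sQ) ?(sorted_catr sQ) //=; last by rewrite adjC.
  by rewrite -lt0n (ltn_trans _ lt).
have e1 : perm_eq (z :: Q.2) (z :: rcons s u ++ t) by rewrite perm_cons perm_sym.
rewrite /vertices /= cats0 (permPr e1).
by apply/permP => p; rewrite /= !count_cat /=; clear; lia.
Qed.

(** Prepending [z] to the path from [u] gives cost 2, while [z] alone cost 3. *)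
Lemma isolated_cycle z Q u t :
  (false, [:: z]) \in C -> Q \in C -> (false, [:: z]) != Q ->
  perm_eq (u :: t) Q.2 -> path adj u t -> adj z u = false.
Proof.
move=> zC QC nzQ pQ sQ; apply/negP => azu.
have := @exchange2 _ _ [:: (false, z :: u :: t)] zC QC nzQ.
rewrite /total_cost big_seq1 {1 3}/cost /= => H; suff: 3 + cost Q <= 2 by clear; lia.
apply: H; first by rewrite /= /valid /= azu sQ.
by rewrite /vertices /= cats0 perm_cons.
Qed.

(** * Weights of path ends and charges of vertices *)

Definition inner (c : bool * seq V) x := \sum_(y <- c.2) mult x y.

Definition outer (c : bool * seq V) x := \sum_(y | y \notin c.2) mult x y.

Lemma inner_outer c x : c \in C -> inner c x + outer c x = 3.
Proof.
move=> /comp_uniq Uc; rewrite -(mult_sum x) /inner /outer (big_uniq _ Uc) /=.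
by rewrite [RHS](bigID (mem c.2)).
Qed.

(* A triangle with one edge doubled, attached to the rest by a bridge. *)
Definition blob c := (size c.2 == 3) && (\sum_(x <- c.2) outer c x <= 1).

(* The charge [x] collects along each edge leaving its component: an isolated
   vertex has three such edges and lacks 4, a blob has a single one and lacks 2. *)
Definition weight (c : bool * seq V) x : nat :=
  if c.1 then 0 else if (size c.2 == 1) || blob c then 2 else
  (x == head x c.2) || (x == last x c.2).

(* What [v] pays to vertices of other components. *)
Definition charge v := \sum_(x | comp_of x != comp_of v) weight (comp_of x) x * mult x v.

Lemma weight_le2 c x : weight c x <= 2.
Proof. by rewrite /weight; case: ifP => // _; case: ifP => // _; case: (_ || _). Qed.

Lemma end_of_path c x s :
  c \in C -> ~~ c.1 -> perm_eq (x :: s) c.2 -> path adj x s -> endof c x.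
Proof. by move=> *; split=> //; exists s. Qed.

Lemma comp_path c : c \in C -> ~~ c.1 -> sorted adj c.2.
Proof. by move=> /comp_valid/andP[_ +] /negPf nc; rewrite nc. Qed.

Lemma head_end c x s : c \in C -> ~~ c.1 -> c.2 = x :: s -> endof c x.
Proof.
move=> cC nc e; apply: (@end_of_path _ _ s) => //; first by rewrite e.
by have := comp_path cC nc; rewrite e.
Qed.

Lemma last_end c x s : c \in C -> ~~ c.1 -> c.2 = rcons s x -> endof c x.
Proof.
move=> cC nc e; apply: (@end_of_path _ _ (rev s)) => //.
  by rewrite -rev_rcons e perm_rev.
have := comp_path cC nc; rewrite -sorted_rev e rev_rcons; exact.
Qed.

Lemma mult_le_outer x v : comp_of x != comp_of v -> mult x v <= outer (comp_of x) x.
Proof.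
move=> nxv; rewrite /outer (bigD1 v) ?leq_addr //=.
by rewrite (mem_comp _ (comp_of_in x)) eq_sym.
Qed.

Lemma weight_end c x :
  c \in C -> x \in c.2 -> 0 < weight c x -> 0 < outer c x -> endof c x.
Proof.
move=> cC xc; rewrite /weight; case: ifPn => // nc.
have endsP : (x == head x c.2) || (x == last x c.2) -> endof c x.
  case/orP => /eqP e.
    case e2: c.2 e xc => [|y s] //= -> _; exact: head_end cC nc e2.
  have [s [y e2]] : exists s y, c.2 = rcons s y.
    by case/lastP: (c.2) xc => [|s y] // _; exists s, y.
  by rewrite e2 last_rcons in e; rewrite e; apply: last_end e2.
case: ifPn => [/orP[s1|/andP[s3 ob]] _ ox|_ w _].
- case e2: c.2 s1 xc => [|y [|z s]] //= _; rewrite inE => /eqP->.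
  exact: head_end e2.
- have sc := comp_path cC nc; case e2: c.2 s3 => [|a [|b [|d [|? ?]]]] // _.
  have oa := inner_outer a cC; have ob' := inner_outer b cC.
  have od := inner_outer d cC.
  move: oa ob' od ob sc; rewrite /inner e2 !big_cons !big_nil !multxx /= /adj.
  rewrite (multC b a) (multC d a) (multC d b) => oa obb od ob /and3P[ab bd _].
  move: xc; rewrite e2 !inE => /or3P[] /eqP xE.
  + by apply: endsP; rewrite e2 xE eqxx.
  (* The middle vertex of the blob takes its only outgoing edge, so degrees force [a] and [d] to be
     adjacent and [b, a, d] is a path. *)
  + move: ox; rewrite xE => ox; apply: (@end_of_path _ _ [:: a; d]) => //.
      rewrite e2; apply/permP => p; rewrite /=; clear; lia.
    rewrite /= /adj (multC b a) ab andbT /=.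
    move: oa obb od ob ab bd ox; clear; lia.
  + by apply: endsP; rewrite e2 xE eqxx orbT.
- by apply: endsP; case: (_ || _) w.
Qed.

Lemma claimer v x :
  comp_of x != comp_of v -> 0 < weight (comp_of x) x -> adj x v -> endof (comp_of x) x.
Proof.
move=> nxv wx axv; have /andP[cC xc] := comp_ofP x.
apply: weight_end => //; exact: leq_trans axv (mult_le_outer nxv).
Qed.

Lemma charge_gt0 v :
  0 < charge v -> exists x, [/\ comp_of x != comp_of v, endof (comp_of x) x & adj x v].
Proof.
case: (pickP (fun x => [&& comp_of x != comp_of v, 0 < weight (comp_of x) x & adj x v])).
  by move=> x /and3P[nxv wx axv] _; exists x; split=> //; apply: claimer axv.
move=> none; rewrite /charge big1 // => x nxv.
by have := none x; rewrite nxv /= /adj -muln_gt0 lt0n => /negbFE/eqP.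
Qed.

Lemma charge_le v : charge v <= 2 * outer (comp_of v) v.
Proof.
rewrite /charge /outer big_distrr /=.
rewrite (eq_bigl (fun y => y \notin (comp_of v).2)); last first.
  by move=> x; rewrite (mem_comp _ (comp_of_in v)).
by apply: leq_sum => x _; rewrite (multC v) leq_mul2r weight_le2 orbT.
Qed.

(** If every claimant had weight at most 1, the charge would not exceed the number of outgoing
    edges. *)
Lemma charge_gt1 v :
  outer (comp_of v) v <= 1 -> 1 < charge v ->
  exists x, [/\ comp_of x != comp_of v, endof (comp_of x) x, adj x v
    & weight (comp_of x) x = 2].
Proof.
move=> ov.
case: (pickP (fun x =>
  [&& comp_of x != comp_of v, 1 < weight (comp_of x) x & adj x v])).
  move=> x /and3P[nxv wx axv] _; exists x; split=> //.
    by apply: claimer axv => //; apply: ltnW.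
  by apply/eqP; rewrite eqn_leq weight_le2.
move=> none; rewrite ltnNge => /negP[]; apply: leq_trans ov.
rewrite /outer (eq_bigl (fun y => comp_of y != comp_of v)); last first.
  by move=> x; rewrite (mem_comp _ (comp_of_in v)).
apply: leq_sum => x nxv; rewrite (multC v).
have := none x; rewrite nxv /= /adj; case: (posnP (mult x v)) => [->|_].
  by rewrite muln0.
rewrite andbT => /negbT; rewrite -leqNgt => w1.
by rewrite -{2}(mul1n (mult x v)) leq_mul2r w1 orbT.
Qed.

Lemma endof_comp c v : endof c v -> comp_of v = c.
Proof.
by case=> cC _ [s ps _]; apply/eqP; rewrite -mem_comp // -(perm_mem ps) mem_head.
Qed.

(** Any claimant is an end of another path, excluded by [no_merge]. *)
Lemma charge_end c v : endof c v -> charge v = 0.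
Proof.
move=> ev; apply/eqP; rewrite -leqn0 leqNgt; apply/negP => /charge_gt0[x [nxv ex axv]].
have cv := endof_comp ev; rewrite cv in nxv.
by rewrite (no_merge ex ev nxv) in axv.
Qed.

Lemma blob_boundary c x y u v :
  blob c -> x \in c.2 -> y \in c.2 -> u \notin c.2 -> v \notin c.2 -> u != v ->
  adj x u -> adj y v -> False.
Proof.
move=> /andP[_ ob] xc yc uc vc nuv axu ayv; move: ob; rewrite /outer exchange_big /=.
rewrite (bigD1 u) //= (bigD1 v) /=; last by rewrite vc eq_sym.
rewrite (big_rem x) //= (big_rem y yc) /=; move: axu ayv; rewrite /adj; clear; lia.
Qed.

Lemma weight_eq2 c x :
  x \in c.2 -> weight c x = 2 -> ~~ c.1 /\ (c = (false, [:: x]) \/ blob c).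
Proof.
rewrite /weight; case: c => [[] s] //= xs; case: ifPn => [|_]; last by case: (_ || _).
case/orP => [s1|bc] _; last by split=> //; right.
case: s xs s1 => [|y [|? ?]] //; rewrite inE => /eqP-> _.
by split=> //; left.
Qed.

(** A charge of 2 at [u] comes from an isolated vertex or a blob. In the first case [isolated_split]
    makes [v] an end, which is never charged. In the second, the single edge leaving the blob is
    used at [u], so [v] is charged by a different path and [no_split_merge] applies. *)
Lemma charge_pair Q s u v t :
  Q \in C -> ~~ Q.1 -> perm_eq (rcons s u ++ v :: t) Q.2 ->
  sorted adj (rcons s u ++ v :: t) -> outer Q u <= 1 -> 0 < charge v -> charge u <= 1.
Proof.
move=> QC Qp pQ sQ ou lv; rewrite leqNgt; apply/negP => lu.
have uQ : u \in Q.2 by rewrite -(perm_mem pQ) mem_cat mem_rcons mem_head.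
have vQ : v \in Q.2 by rewrite -(perm_mem pQ) mem_cat mem_head orbT.
have cu : comp_of u = Q by apply/eqP; rewrite -mem_comp.
have cv : comp_of v = Q by apply/eqP; rewrite -mem_comp.
have nuv : u != v.
  have := comp_uniq QC; rewrite -(perm_uniq pQ) cat_uniq => /and3P[_ /hasPn/(_ v)].
  by rewrite mem_head mem_rcons inE eq_sym => /(_ isT)/norP[].
have [|x [nxu ex axu w2]] := charge_gt1 _ lu; first by rewrite cu.
have [y [nyv ey ayv]] := charge_gt0 lv.
rewrite cu in nxu; rewrite cv in nyv.
have /andP[xC xx] := comp_ofP x; have /andP[yC yy] := comp_ofP y.
have [xp [xE|bx]] := weight_eq2 xx w2.
  rewrite xE in xC nxu.
  have := isolated_split xC QC nxu Qp pQ sQ axu; rewrite ltnS leqn0 => /eqP/size0nil t0.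
  suff ev : endof Q v by rewrite (charge_end ev) in lv.
  apply: (@end_of_path _ _ (rev (rcons s u))) => //.
    by rewrite -(permPr pQ) t0 cats1 -rev_rcons perm_rev.
  by move: sQ; rewrite t0 cats1 -sorted_rev (rev_rcons (rcons s u)).
have [e|nxy] := eqVneq (comp_of x) (comp_of y).
  rewrite -e in yy; apply: (blob_boundary bx xx yy _ _ nuv axu ayv);
    by rewrite mem_comp // (cu, cv) eq_sym.
exact: (no_split_merge ex ey nxy nxu nyv QC Qp pQ sQ axu ayv).
Qed.

(** As for [charge_pair], with [isolated_cycle] and [no_open_cycle] as the forbidden exchanges. *)
Lemma charge_pair_cycle Q v s u :
  Q \in C -> perm_eq (rcons (v :: s) u) Q.2 ->
  sorted adj (rcons (v :: s) u) -> outer Q u <= 1 -> 0 < charge v -> charge u <= 1.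
Proof.
move=> QC pQ sQ ou lv; rewrite leqNgt; apply/negP => lu.
have uQ : u \in Q.2 by rewrite -(perm_mem pQ) mem_rcons mem_head.
have vQ : v \in Q.2 by rewrite -(perm_mem pQ) mem_rcons inE mem_head orbT.
have cu : comp_of u = Q by apply/eqP; rewrite -mem_comp.
have cv : comp_of v = Q by apply/eqP; rewrite -mem_comp.
have nuv : u != v.
  have := comp_uniq QC; rewrite -(perm_uniq pQ) rcons_uniq inE negb_or.
  by case/andP=> /andP[].
have [|x [nxu ex axu w2]] := charge_gt1 _ lu; first by rewrite cu.
have [y [nyv ey ayv]] := charge_gt0 lv.
rewrite cu in nxu; rewrite cv in nyv.
have /andP[xC xx] := comp_ofP x; have /andP[yC yy] := comp_ofP y.
have [xp [xE|bx]] := weight_eq2 xx w2.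
  rewrite xE in xC nxu.
  suff : adj x u = false by rewrite axu.
  apply: (isolated_cycle xC QC nxu (t := rev (v :: s))).
    by rewrite -rev_rcons perm_rev.
  by move: sQ; rewrite -sorted_rev (rev_rcons (v :: s)).
have [e|nxy] := eqVneq (comp_of x) (comp_of y).
  rewrite -e in yy; apply: (blob_boundary bx xx yy _ _ nuv axu ayv);
    by rewrite mem_comp // (cu, cv) eq_sym.
exact: (no_open_cycle ex ey nxy nxu nyv QC pQ sQ axu ayv).
Qed.


(** * Balance of charges, and the charge lost by a cycle *)

Definition outflow c := \sum_(x <- c.2) weight c x * outer c x.

(** Both sides count the edges between distinct components, weighted at the claiming vertex. *)
Lemma flow_balance :
  \sum_(c <- C) \sum_(v <- c.2) charge v = \sum_(c <- C) outflow c.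
Proof.
rewrite /outflow !sum_comps /charge.
under eq_bigr do rewrite big_mkcond /=.
rewrite exchange_big /=; apply: eq_bigr => x _.
rewrite -big_mkcond /= /outer big_distrr /=; apply: eq_bigl => v.
by rewrite (mem_comp _ (comp_of_in x)) eq_sym.
Qed.

Lemma sum_ge2 (f : V -> nat) (s : seq V) x y :
  x \in s -> y \in s -> x != y -> f x + f y <= \sum_(z <- s) f z.
Proof.
move=> xs ys nxy; rewrite (big_rem x) //= leq_add2l.
have yr : y \in rem x s.
  by have /perm_mem/(_ y) := perm_to_rem xs; rewrite ys inE eq_sym (negPf nxy).
by rewrite (big_rem y) //= leq_addr.
Qed.

(** The two cycle neighbours of [u] are distinct and use up two of its three edges. *)
Lemma cycle_outer Q s u :
  Q \in C -> perm_eq s Q.2 -> cycle adj s -> 2 < size s -> u \in Q.2 ->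
  outer Q u <= 1.
Proof.
move=> QC pQ cs s3; rewrite -(perm_mem pQ) => /rot_to[i t e].
have pt : perm_eq (u :: t) Q.2 by rewrite -e perm_rot.
have Ut := comp_uniq QC; rewrite -(perm_uniq pt) in Ut.
have st : 2 < size (u :: t) by rewrite -e size_rot.
have := cs; rewrite -(rot_cycle i) e /=.
case/lastP: t pt Ut st {e} => [|t z]; first by [].
case: t => [|y t] // pt Ut _; rewrite rcons_path last_rcons /= => /andP[/andP[auy _]].
rewrite adjC => auz; have nyz : y != z.
  by move: Ut => /= /and3P[_]; rewrite mem_rcons inE => /norP[].
have i2 : 2 <= inner Q u.
  apply: leq_trans (@sum_ge2 (mult u) Q.2 _ _ _ _ nyz); first exact: leq_add auy auz.
    by rewrite -(perm_mem pt) !inE eqxx orbT.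
  by rewrite -(perm_mem pt) !(inE, mem_rcons) eqxx !orbT.
by have := inner_outer u QC; move: i2; clear; lia.
Qed.

Lemma path_outer Q s u v w t :
  Q \in C -> perm_eq (rcons s u ++ v :: w :: t) Q.2 ->
  sorted adj (rcons s u ++ v :: w :: t) -> outer Q v <= 1.
Proof.
move=> QC pQ; rewrite cat_rcons => /sorted_catr /= /and3P[auv avw _].
have Ut := comp_uniq QC; rewrite -(perm_uniq pQ) in Ut.
have nuw : u != w.
  move: Ut; rewrite cat_rcons cat_uniq => /and3P[_ _ /= /andP[+ _]].
  by rewrite !inE => /norP[_ /norP[]].
have i2 : 2 <= inner Q v.
  apply: leq_trans (@sum_ge2 (mult v) Q.2 _ _ _ _ nuw).
  - by apply: (@leq_add 1 1) => //; rewrite multC.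
  - by rewrite -(perm_mem pQ) mem_cat mem_rcons mem_head.
  - by rewrite -(perm_mem pQ) mem_cat !inE eqxx !orbT.
by have := inner_outer v QC; move: i2; clear; lia.
Qed.

Lemma sum_pairs (f : V -> nat) s :
  sorted (fun u v => f u + f v <= 2) s -> ~~ odd (size s) ->
  \sum_(x <- s) f x <= size s.
Proof.
have [n le_n] := ubnP (size s); elim: n s le_n => // n IH [|u [|v s]] //= le_n.
  by rewrite big_nil.
move=> /andP[uv ps]; rewrite negbK => os; rewrite !big_cons.
have lt_s : size s < n by move: le_n; clear; lia.
by have := IH s lt_s (path_sorted ps) os; move: uv; clear; lia.
Qed.

Lemma split_nth (s : seq V) x0 k : k.+1 < size s ->
  s = rcons (take k s) (nth x0 s k) ++ nth x0 s k.+1 :: drop k.+2 s.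
Proof.
move=> lk; rewrite -(drop_nth _ lk) -(take_nth _ (ltnW lk)).
by rewrite cat_take_drop.
Qed.

(** A vertex has at most one outgoing edge, hence charge at most 2. If two consecutive vertices are
    both charged, [charge_pair_cycle] in both directions leaves at most 1 for each. Even length lets
    the vertices be paired off. *)
Lemma cycle_charge Q : Q \in C -> Q.1 -> \sum_(v <- Q.2) charge v <= size Q.2.
Proof.
move=> QC Qc; have /andP[nQ] := comp_valid QC; rewrite Qc => /and3P[cQ eQ dQ].
have o1 u : u \in Q.2 -> outer Q u <= 1.
  move=> uQ; have [Q3|] := ltnP 2 (size Q.2); first exact: cycle_outer cQ Q3 uQ.
  have := inner_outer u QC; rewrite /inner.
  case: (Q.2) nQ cQ eQ dQ uQ => [|a [|b [|? ?]]] //= _ _ _ ab.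
  rewrite !big_cons big_nil !inE => /orP[/eqP e|/eqP e]; rewrite e multxx;
    have := multC a b; move: ab; clear; lia.
apply: sum_pairs => //; have [x0 _] : exists x0, x0 \in Q.2.
  by case: (Q.2) nQ => // x0 t _; exists x0; apply: mem_head.
apply/(sortedP x0) => k lk; have := split_nth x0 lk.
move: (take k _) (nth _ _ k) (nth _ _ k.+1) (drop k.+2 _) => s u v t e.
(* The cycle is opened between [u] and [v]. *)
have pr : perm_eq (rcons (v :: t ++ s) u) Q.2.
  by rewrite e -cats1 -!cat_cons -catA cats1 perm_catC.
have sr : sorted adj (rcons (v :: t ++ s) u).
  move: cQ; rewrite e -(rot_cycle (size (rcons s u))) rot_size_cat.
  rewrite -cats1 !cat_cons catA cats1 /= rcons_path; by case/andP.
have uQ : u \in Q.2 by rewrite -(perm_mem pr) mem_rcons mem_head.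
have vQ : v \in Q.2 by rewrite -(perm_mem pr) mem_rcons inE mem_head orbT.
have := charge_pair_cycle QC pr sr (o1 u uQ).
have := @charge_pair_cycle Q u (rev (t ++ s)) v QC.
rewrite -[rcons _ v]/(u :: rcons _ v) -rev_cons -rev_rcons perm_rev sorted_rev.
move=> /(_ pr sr (o1 v vQ)).
have := charge_le u; have := charge_le v; have := o1 u uQ; have := o1 v vQ.
have /eqP-> : comp_of u == Q by rewrite -mem_comp.
have /eqP-> : comp_of v == Q by rewrite -mem_comp.
clear; lia.
Qed.

(** * The charge lost by a path *)

Section PathComponent.
Variable Q : bool * seq V.
Hypotheses (QC : Q \in C) (Qp : ~~ Q.1).

(** Going from [u] back to the head, across to [v] and on makes [u] an end, of charge 0. At [v] one
    edge leads to [w] and, if [s] is nonempty, one to [u]; each other edge contributes at most 2, as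
    charge or as an edge to the head. *)
Lemma charge_next_head s u v w t :
  perm_eq (rcons s u ++ v :: w :: t) Q.2 ->
  sorted adj (rcons s u ++ v :: w :: t) -> adj (head u s) v ->
  charge u + charge v + 2 * mult (head u s) v <= 2 + 2 * nilp s.
Proof.
move=> pQ sQ; have Us := comp_uniq QC; rewrite -(perm_uniq pQ) in Us.
have vQ : v \in Q.2 by rewrite -(perm_mem pQ) mem_cat mem_head orbT.
have cv : comp_of v = Q by apply/eqP; rewrite -mem_comp.
have := sQ; rewrite cat_rcons => /sorted_catr /= /and3P[auv avw pt].
have := charge_le v; rewrite cv; have := inner_outer v QC.
rewrite /inner -(perm_big _ pQ) big_cat /= big_rcons !big_cons /=.
move: auv avw; rewrite /adj (multC u v) => auv avw io lv.
case: s pQ sQ Us io => [|q s] pQ sQ Us /= io aqv.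
  have -> : charge u = 0 by apply: charge_end (end_of_path QC Qp pQ _).
  by move: io; rewrite big_nil (multC u v); move: lv avw; clear; lia.
move: io; rewrite big_cons /= (multC v q) => io.
have -> : charge u = 0.
  apply: charge_end (end_of_path QC Qp (s := rev (q :: s) ++ v :: w :: t) _ _).
    rewrite -(permPr pQ) -cats1; apply/permP => p.
    rewrite /= !count_cat count_rev /=; clear; lia.
  have := @sorted_join (u :: rev s) q v (w :: t).
  rewrite -[rcons (u :: _) q]/(u :: rcons _ q) -rev_cons -rev_rcons sorted_rev.
  rewrite rev_rcons => H; apply: H => //; first exact: sorted_catl sQ.
  by have := sorted_catr sQ.
move: lv auv avw aqv io; rewrite /adj; clear; lia.
Qed.

(* Summed along the path, the bound trades each edge from an end of [Q] back to
   [Q] against charge lost by [Q]. If the path is [s u v t], an edge from its head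
   to [v] lets [u] become an end, and likewise an edge from its last vertex to [u]
   lets [v] become one; both edges together close [Q] into a cycle. *)
Lemma charge_next s u v t :
  2 < size Q.2 -> perm_eq (rcons s u ++ v :: t) Q.2 ->
  sorted adj (rcons s u ++ v :: t) ->
  ~~ (adj (head u s) v && adj (last v t) u) ->
  charge u + charge v + 2 * mult (head u s) v + 2 * mult (last v t) u
    <= 2 + 2 * nilp s + 2 * nilp t.
Proof.
move=> Q3 pQ sQ nh.
have rE (a b : seq V) x y : rev (rcons a x ++ y :: b) = rcons (rev b) y ++ x :: rev a.
  by rewrite rev_cat rev_rcons rev_cons.
have auv : adj u v by have := sQ; rewrite cat_rcons => /sorted_catr /andP[].
have [/andP[tn aq]|] := boolP ((t != [::]) && adj (head u s) v).
  have -> : mult (last v t) u = 0.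
    by move: nh; rewrite aq /= /adj -eqn0Ngt => /eqP.
  case: t pQ sQ tn {nh} => // w t pQ sQ _.
  by have := charge_next_head pQ sQ aq; clear; lia.
have [/andP[sn al] _|] := boolP ((s != [::]) && adj (last v t) u).
  have -> : mult (head u s) v = 0.
    by move: nh; rewrite al andbT /adj -eqn0Ngt => /eqP.
  case/lastP: s pQ sQ sn {nh} => // s w pQ sQ _.
  (* The case of the last vertex is that of the head on the reversed path. *)
  have := @charge_next_head (rev t) v u w (rev s).
  rewrite -rev_rcons -rE perm_rev sorted_rev head_rev => /(_ pQ sQ al).
  rewrite {1}/nilp size_rev -/(nilp t) muln0 addn0 (addnC (charge u)).
  by move=> H; rewrite (leq_trans H) // addnAC leq_addr.
have [s0|sn] := eqVneq s [::].
  rewrite s0 /= auv andbT negbK => _ /eqP t0.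
  by move: Q3; rewrite -(perm_size pQ) s0 t0.
have [t0|tn] := eqVneq t [::].
  by rewrite t0 /= (adjC v) auv.
rewrite /= /adj -!eqn0Ngt => /eqP-> /eqP->.
have uQ : u \in Q.2 by rewrite -(perm_mem pQ) mem_cat mem_rcons mem_head.
have vQ : v \in Q.2 by rewrite -(perm_mem pQ) mem_cat mem_head orbT.
have ov : outer Q v <= 1.
  by case: t pQ sQ tn {nh} => // w t pQ sQ _; apply: path_outer sQ.
have pQr : perm_eq (rcons (rev t) v ++ u :: rev s) Q.2 by rewrite -rE perm_rev.
have sQr : sorted adj (rcons (rev t) v ++ u :: rev s) by rewrite -rE sorted_rev.
have ou : outer Q u <= 1.
  case/lastP: s pQr sQr sn {nh pQ sQ} => // s w; rewrite rev_rcons => pQr sQr _.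
  exact: path_outer sQr.
have := charge_pair QC Qp pQ sQ ou; have := charge_pair QC Qp pQr sQr ov.
have := charge_le u; have := charge_le v; move: ou ov.
have /eqP-> : comp_of u == Q by rewrite -mem_comp.
have /eqP-> : comp_of v == Q by rewrite -mem_comp.
clear; lia.
Qed.


Lemma cycle_join (a b : seq V) x y :
  a != [::] -> b != [::] -> sorted adj a -> sorted adj b ->
  adj (last x a) (head y b) -> adj (last y b) (head x a) -> cycle adj (a ++ b).
Proof.
case: a => // h a _; case: b => // g b _ /= pa pb ag bh.
by rewrite rcons_path cat_path last_cat /= pa ag pb.
Qed.

(** Every vertex of a Hamiltonian cycle is an end, hence uncharged, and an even cycle would be
    cheaper than the path. *)
Lemma closable_charge s :
  perm_eq s Q.2 -> cycle adj s -> 2 < size s ->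
  \sum_(v <- Q.2) charge v = 0 /\ odd (size Q.2).
Proof.
move=> ps cs s3; split.
  apply: big1_seq => v /andP[_]; rewrite -(perm_mem ps) => /rot_to[i t e].
  apply: charge_end (end_of_path QC Qp (s := t) _ _).
    by rewrite -e perm_rot.
  by move: cs; rewrite -(rot_cycle i) e /= rcons_path; case/andP.
apply: contraT => es; case: (no_close QC Qp ps).
rewrite /even_cycle cs (perm_size ps) es /=.
by case: (s) s3 => [|? [|? []]].
Qed.

Lemma sum_eq_ord n a : \sum_(k < n) (k == a :> nat) = (a < n).
Proof.
elim: n => [|n IH]; first by rewrite big_ord0.
by rewrite big_ord_recr /= IH; clear; lia.
Qed.

(** Adding [charge_next] over the consecutive pairs counts each charge twice, as the two ends have
    charge 0. The first and last pairs add at most 4 in total, and everything is then halved. *)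
Lemma path_charge x0 :
  2 < size Q.2 ->
  (forall s u v t, Q.2 = rcons s u ++ v :: t ->
     ~~ (adj (head u s) v && adj (last v t) u)) ->
  \sum_(v <- Q.2) charge v + inner Q (head x0 Q.2) + inner Q (last x0 Q.2)
    <= (size Q.2).+1.
Proof.
move=> Q3 nh; case sz: (size Q.2) Q3 => [//|n] Q3.
set s := Q.2 in sz nh *; set q0 := head x0 s; set ql := last x0 s.
have eq0 : nth x0 s 0 = q0 by rewrite nth0.
have eql : nth x0 s n = ql by rewrite -[n]/(n.+1.-1) -sz nth_last.
have Sl f : \sum_(v <- s) f v = f q0 + \sum_(k < n) f (nth x0 s k.+1).
  by rewrite (big_nth x0) sz big_mkord big_ord_recl eq0.
have Sr f : \sum_(v <- s) f v = \sum_(k < n) f (nth x0 s k) + f ql.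
  by rewrite (big_nth x0) sz big_mkord big_ord_recr /= eql.
have L0 : charge q0 = 0.
  case e: s sz => [//|a t] _; rewrite /q0 e /=; apply: charge_end (head_end QC Qp e).
have Ll : charge ql = 0.
  have [t [a e]] : exists t a, s = rcons t a.
    by case/lastP: (s) sz => [|t a] // _; exists t, a.
  by rewrite /ql e last_rcons; apply: charge_end (last_end QC Qp e).
have H (k : 'I_n) :
    charge (nth x0 s k) + charge (nth x0 s k.+1) + 2 * mult q0 (nth x0 s k.+1)
    + 2 * mult ql (nth x0 s k) <= 2 + 2 * (k == 0 :> nat) + 2 * (k == n.-1 :> nat).
  have lk : k.+1 < size s by rewrite sz ltnS.
  have e := split_nth x0 lk.
  have e0 : q0 = head (nth x0 s k) (take k s).
    rewrite /q0; case: (s) lk => // a t _; case: (nat_of_ord k) => //=.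
  have el : ql = last (nth x0 s k.+1) (drop k.+2 s).
    by rewrite /ql {1}e last_cat last_rcons /=.
  rewrite e0 el.
  have := @charge_next (take k s) (nth x0 s k) (nth x0 s k.+1) (drop k.+2 s).
  rewrite -e -/s sz => /(_ Q3 (perm_refl _) (comp_path QC Qp) (nh _ _ _ _ e)).
  move=> H; apply: leq_trans H _; rewrite /nilp size_drop size_takel ?sz; last first.
    by move: lk; rewrite sz; clear; lia.
  suff -> : (n.+1 - k.+2 == 0) = (k == n.-1 :> nat) by [].
  by have := ltn_ord k; clear; lia.
have HS : \sum_(k < n) (charge (nth x0 s k) + charge (nth x0 s k.+1)
      + 2 * mult q0 (nth x0 s k.+1) + 2 * mult ql (nth x0 s k))
    <= \sum_(k < n) (2 + 2 * (k == 0 :> nat) + 2 * (k == n.-1 :> nat)).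
  by apply: leq_sum => k _; apply: H.
move: HS; rewrite !big_split /= !sum_eq_ord !sum_nat_const !card_ord.
have := Sl charge; have := Sr charge; rewrite L0 Ll.
have := Sl (mult q0); have := Sr (mult ql); rewrite !multxx /inner -/s.
have := leq_b1 (n.-1 < n); have := leq_b1 (0 < n); rewrite !muln0 !addn0 !add0n.
move: (\sum_(v <- s) charge v) (\sum_(v <- s) mult q0 v) (\sum_(v <- s) mult ql v).
move: (nat_of_bool (0 < n)) (nat_of_bool (n.-1 < n)) => b b' X Y Z b1 b1'.
by move=> <- <- <- <-; move: b1 b1'; clear; lia.
Qed.

Lemma weight_path_end x :
  size Q.2 != 1 -> ~~ blob Q -> (x == head x Q.2) || (x == last x Q.2) ->
  weight Q x = 1.
Proof. by rewrite /weight => /negPf-> /negPf-> ->; rewrite (negPf Qp). Qed.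

(** Generically the two ends send out 6 edges minus their inner ones, and [path_charge] concludes.
    Paths on at most two vertices, blobs and paths that close into a cycle are treated apart. *)
Lemma path_bound : \sum_(v <- Q.2) charge v + 5 <= size Q.2 + outflow Q.
Proof.
have [Q3|Q2] := ltnP 2 (size Q.2); last first.
  have okQ := comp_valid QC; case e: Q.2 Q2 => [|a [|b [|? ?]]] // _.
  - by move: okQ; rewrite /valid e.
  - rewrite /outflow e !big_seq1 (charge_end (head_end QC Qp e)) /weight e /=.
    have := inner_outer a QC; rewrite /inner e big_seq1 multxx (negPf Qp).
    clear; lia.
  - have nb : ~~ blob Q by rewrite /blob e.
    have n1 : size Q.2 != 1 by rewrite e.
    rewrite /outflow e !big_cons !big_nil (charge_end (head_end QC Qp e)).
    rewrite (charge_end (last_end (s := [:: a]) QC Qp e)).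
    rewrite !weight_path_end ?e ?eqxx ?orbT //.
    have := inner_outer a QC; have := inner_outer b QC.
    rewrite /inner e !big_cons !big_nil !multxx (multC b a).
    have : mult a b <= 1.
      rewrite leqNgt; apply/negP => ab; apply: (@no_close Q [:: a; b]) => //.
        by rewrite e.
      by rewrite /even_cycle /= /adj (multC b a) ab (ltnW ab).
    rewrite /=; clear; lia.
have [bQ|nb] := boolP (blob Q).
  (* The degree sum 9 is odd, so some edge leaves the blob. *)
  have o1 : 1 <= \sum_(x <- Q.2) outer Q x.
    case/andP: bQ; case e: Q.2 => [|a [|b [|d [|? ?]]]] // _ _.
    have := inner_outer a QC; have := inner_outer b QC; have := inner_outer d QC.
    rewrite /inner e !big_cons !big_nil !multxx (multC b a) (multC d a) (multC d b).
    clear; lia.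
  have wE x : weight Q x = 2 by rewrite /weight (negPf Qp) bQ orbT.
  have -> : \sum_(v <- Q.2) charge v = 0.
    apply: big1_seq => v /andP[_ vQ]; apply/eqP; rewrite -leqn0 leqNgt.
    apply/negP => lv; have [x [nxv _ axv]] := charge_gt0 lv.
    suff ev : endof Q v by rewrite (charge_end ev) in lv.
    have cv : comp_of v = Q by apply/eqP; rewrite -mem_comp.
    apply: weight_end => //; first by rewrite wE.
    rewrite -cv; apply: leq_trans (@mult_le_outer v x _); last by rewrite eq_sym.
    by rewrite multC.
  have -> : outflow Q = 2 * \sum_(x <- Q.2) outer Q x.
    by rewrite big_distrr; apply: eq_bigr => x _; rewrite wE.
  move: Q3 o1; clear; lia.
have n1 : size Q.2 != 1 by move: Q3; clear; lia.
have [x0 _] : exists x0, x0 \in Q.2.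
  by case: (Q.2) Q3 => // x0 t _; exists x0; apply: mem_head.
set q := head x0 Q.2; set l := last x0 Q.2.
have [qQ lQ nql] : [/\ q \in Q.2, l \in Q.2 & q != l].
  rewrite /q /l; have := comp_uniq QC; case: (Q.2) Q3 => // a t t0 /= /andP[at_ _].
  rewrite mem_head mem_last; split=> //; apply: contraNneq at_ => ->.
  by case: t t0 => //= b t _; apply: mem_last.
have out_ends : outer Q q + outer Q l <= outflow Q.
  have := @sum_ge2 (fun x => weight Q x * outer Q x) _ _ _ qQ lQ nql.
  rewrite !weight_path_end ?mul1n //.
    by rewrite /l; case: (Q.2) Q3 => //= a t _; rewrite eqxx orbT.
  by rewrite /q; case: (Q.2) Q3 => //= a t _; rewrite eqxx.
have := inner_outer q QC; have := inner_outer l QC.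
(* Two such crossing edges close the path into a Hamiltonian cycle: the first [k.+1] vertices
   forwards, then the rest backwards. *)
pose ham k := adj q (nth x0 Q.2 k.+1) && adj l (nth x0 Q.2 k).
have [/existsP[k hk]|nham] := boolP [exists k : 'I_(size Q.2).-1, ham k]; last first.
  have nh s u v t : Q.2 = rcons s u ++ v :: t ->
      ~~ (adj (head u s) v && adj (last v t) u).
    move=> e; have lk : size s < (size Q.2).-1.
      by rewrite e size_cat size_rcons /= addnS ltnS leq_addr.
    have := nham; rewrite negb_exists => /forallP/(_ (Ordinal lk)).
    rewrite /ham /= /q /l e last_cat /= !nth_cat size_rcons ltnS leqnn ltnn subnn /=.
    by rewrite nth_rcons ltnn eqxx; case: (s).
  have := path_charge x0 Q3 nh; rewrite -/q -/l; move: out_ends; clear; lia.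
have lk : k.+1 < size Q.2 by have := ltn_ord k; move: Q3; clear; lia.
move: (nat_of_ord k) hk lk => {}k hk lk.
pose s := take k.+1 Q.2 ++ rev (drop k.+1 Q.2).
have sQ := comp_path QC Qp; rewrite -[Q.2](cat_take_drop k.+1) in sQ.
have ps : perm_eq s Q.2.
  by rewrite -[X in perm_eq _ X](cat_take_drop k.+1) perm_cat2l perm_rev.
have cs : cycle adj s.
  case/andP: hk => hq hl; apply: (@cycle_join _ _ x0 x0).
  - by rewrite -size_eq0 size_takel // ltnW.
  - by rewrite -size_eq0 size_rev size_drop -lt0n subn_gt0.
  - exact: sorted_catl sQ.
  - by rewrite sorted_rev; apply: sorted_catr sQ.
  - rewrite (take_nth x0 (ltnW lk)) (drop_nth x0 lk) last_rcons head_rev /= adjC.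
    by move: hl; rewrite /l -{1}(cat_take_drop k.+1 Q.2) last_cat (drop_nth x0 lk).
  - rewrite (drop_nth x0 lk) rev_cons last_rcons adjC.
    by move: hq; rewrite /q; case: (Q.2).
have s3 : 2 < size s by rewrite (perm_size ps).
have [-> oQ] := closable_charge ps cs s3.
have [Q5|Q5] := ltnP 4 (size Q.2); first by move: Q5; clear; lia.
(* Each vertex of the triangle has at most one outgoing edge. Not being a blob, it has at least two
   in all, hence three by parity, so both ends have one. *)
have {oQ Q5} : size Q.2 = 3 by move: oQ Q5 Q3; case: (size Q.2) => [|[|[|[|[|]]]]].
move: nb out_ends; rewrite /blob /q /l.
have := fun x => cycle_outer (u := x) QC ps cs s3.
case e: Q.2 => [|a [|b [|d [|? ?]]]] //= o1 nb out_ends _.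
have := o1 a; have := o1 b; have := o1 d; rewrite !inE !eqxx !orbT.
have := inner_outer b QC; move: nb out_ends.
rewrite /inner e !big_cons !big_nil !multxx (multC b a) (multC d a) (multC d b).
clear; lia.
Qed.

End PathComponent.

(** The bounds for single components are added; charges and outflows cancel by [flow_balance]. *)
Lemma minimal_cover_paths : 5 * count (fun c => ~~ c.1) C <= #|V|.
Proof.
have nV : #|V| = \sum_(c <- C) size c.2.
  have /andP[_ /perm_size] := Ccov; rewrite -cardE => <-.
  by rewrite /vertices size_flatten sumnE /shape !big_map.
have bal : \sum_(c <- C) (5 * ~~ c.1 + \sum_(v <- c.2) charge v)
         <= \sum_(c <- C) (size c.2 + outflow c).
  rewrite !(big_seq_cond predT) leq_sum // => c /andP[cC _].
  have [c1|c1] := boolP c.1; last by rewrite addnC; apply: path_bound.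
  exact: leq_trans (cycle_charge cC c1) (leq_addr _ _).
have -> : 5 * count (fun c => ~~ c.1) C = \sum_(c <- C) 5 * ~~ c.1.
  rewrite -sum1_count big_mkcond big_distrr /=.
  by apply: eq_bigr => c _; case: c.1.
move: bal; rewrite big_split /= [X in _ <= X]big_split /= flow_balance leq_add2r.
by rewrite nV.
Qed.

End Minimal.
End Covers.

(** * From covers of a cubic graph to edge colorings *)

Section CubicGraph.
Variables (V E : finType) (src tgt : E -> V).
Hypothesis noloop : loopless src tgt.
Hypothesis cubicG : cubic src tgt.

Local Notation inc := (incident src tgt).

(** The condition [x != y] makes the diagonal 0 instead of the degree. *)
Definition mult x y := #|[pred e | [&& inc x e, inc y e & x != y]]|.

Lemma mult_sym x y : mult x y = mult y x.
Proof. by apply: eq_card => e; rewrite !inE eq_sym andbCA. Qed.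

Lemma mult_irrefl x : mult x x = 0.
Proof. by apply: eq_card0 => e; rewrite !inE eqxx !andbF. Qed.

Lemma edge_ends x y e : inc x e -> inc y e -> x != y ->
  (forall z, inc z e = (z \in [:: x; y])) /\
  (forall f, adjacent src tgt e f = inc x f || inc y f).
Proof.
rewrite /incident /adjacent => /orP[]/eqP<- /orP[]/eqP<-; rewrite ?eqxx // => _.
  by split=> z //; rewrite !inE !(eq_sym z).
by split=> z; rewrite ?inE ?(eq_sym z) orbC.
Qed.

Lemma mult_degree x : \sum_y mult x y = 3.
Proof.
have /forallP/(_ x)/eqP <- := cubicG; rewrite /degree cardsE -sum1_card.
under eq_bigr do rewrite /mult -sum1_card big_mkcond /=.
rewrite exchange_big [RHS]big_mkcond /=; apply: eq_bigr => e _.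
rewrite -big_mkcond /=; have /forallP/(_ e) ne := noloop.
rewrite [e \in _](_ : _ = inc x e) //.
have [xe|/negPf xe] := boolP (inc x e); last first.
  by rewrite big_pred0 // => y; rewrite inE /= xe.
have [y ye nxy] : exists2 y, inc y e & x != y.
  case/orP: xe => /eqP<-; first by exists (tgt e); rewrite // /incident eqxx orbT.
  by exists (src e); rewrite 1?eq_sym // /incident eqxx.
rewrite (big_pred1 y) // => z; have [incE _] := edge_ends xe ye nxy.
rewrite inE /= xe incE !inE; rewrite (eq_sym x z).
by have [->|_] := eqVneq z x; rewrite ?(negPf nxy) ?andbF ?andbT.
Qed.

Lemma adjP x y : adj mult x y -> exists e, [/\ inc x e, inc y e & x != y].
Proof. by move=> /card_gt0P[e]; rewrite inE => /and3P[]; exists e. Qed.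

(** A pairwise compatible list of colored edges is a proper 2-coloring of distinct edges. *)
Definition compat : rel (E * bool) := fun p q =>
  (p.1 != q.1) && (adjacent src tgt p.1 q.1 ==> (p.2 != q.2)).

Definition within (s : seq V) (p : E * bool) := (src p.1 \in s) && (tgt p.1 \in s).

Lemma within_inc s p z : within s p -> inc z p.1 -> z \in s.
Proof. by case/andP=> ? ? /orP[]/eqP<-. Qed.

Lemma within_sub (s t : seq V) p : {subset s <= t} -> within s p -> within t p.
Proof. by move=> st /andP[/st a /st b]; apply/andP. Qed.

Lemma inc_within (s : seq V) p :
  (forall z, inc z p.1 -> z \in s) -> within s p.
Proof. by move=> h; apply/andP; split; apply: h; rewrite /incident eqxx ?orbT. Qed.

(** Colors alternate from [b]. The last two clauses record the colors at both ends, for extending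
    the path or closing it. *)
Lemma path_coloring x s b : path (adj mult) x s -> uniq (x :: s) ->
  exists L : seq (E * bool),
    [/\ size L = size s, pairwise compat L, all (within (x :: s)) L,
        forall p, p \in L -> inc x p.1 -> p.2 = b
      & forall p, p \in L -> inc (last x s) p.1 -> p.2 = b (+) ~~ odd (size s)].
Proof.
elim: s x b => [|y s IH] x b /=; first by exists [::].
case/andP=> /adjP[e [xe ye nxy]] ps /andP[xs Us].
have [L [sL cL wL hL lL]] := IH y (~~ b) ps Us.
have [incE adjE] := edge_ends xe ye nxy.
have Lx p : p \in L -> inc x p.1 = false.
  move=> pL; apply: contraNF xs; exact: within_inc (allP wL _ pL).
exists ((e, b) :: L); split.
- by rewrite /= sL.
- rewrite /= cL andbT; apply/allP => p pL; apply/andP; split=> /=.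
    by apply: contraTneq xe => ->; rewrite Lx.
  by apply/implyP; rewrite adjE Lx //= => /(hL _ pL)->; case: (b).
- rewrite /= inc_within => [|z]; last by rewrite incE !inE => /orP[]->; rewrite ?orbT.
  by apply: sub_all wL => p; apply: within_sub => z zs; rewrite inE zs orbT.
- by move=> p; rewrite inE => /orP[/eqP->//|/Lx->].
- move=> p; rewrite inE => /orP[/eqP->|/lL h /h->]; last by rewrite addNb -addbN.
  rewrite incE !inE => /orP[]/eqP el.
    by rewrite -el mem_last in xs.
  case: (s) el Us => [|z t] /= el; first by rewrite addbF.
  by rewrite -el mem_last.
Qed.

(** On an even cycle, the path from [y] to the last vertex has evenly many edges; it starts with
    [false] and ends with [true], so [e1] can take [true] and the closing edge [e0] can take
    [false]. *)
Lemma component_coloring c : valid mult c -> uniq c.2 ->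
  exists L : seq (E * bool),
    [/\ size L + ~~ c.1 = size c.2, pairwise compat L & all (within c.2) L].
Proof.
case: c => [[] [|x s]] /andP[] //= _; last first.
  move=> ps Us; have [L [sL cL wL _ _]] := path_coloring true ps Us.
  by exists L; rewrite sL addn1.
case/and3P=> cs es ds Us.
case: s cs es ds Us => [|y s]; first by rewrite /= /adj mult_irrefl.
rewrite /= rcons_path negbK => /and3P[axy ps alx] es ds /andP[xs Us].
have [L [sL cL wL hL lL]] := path_coloring false ps Us.
have [e1 [xe1 ye1 nxy]] := adjP axy.
(* On two vertices the closing edge is a second parallel edge. *)
have [e0 [le0 xe0 nlx] ne] : exists2 e0,
    [/\ inc (last y s) e0, inc x e0 & last y s != x] & e0 != e1.
  case: s ds alx xs Us {es ps sL cL wL hL lL} => [|z s] ds alx xs Us.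
    have /card_gt1P[e [f [+ + nef]]] := ds.
    rewrite !inE => /and3P[xe ye _] /and3P[xf yf _].
    have [ee|ne] := eqVneq e e1.
      by exists f; [split=> //; rewrite eq_sym | rewrite -ee eq_sym].
    by exists e; first by split=> //; rewrite eq_sym.
  have [e0 [le0 xe0 nlx]] := adjP alx; exists e0 => //.
  apply/eqP => ee; move: le0; rewrite ee; have [-> _] := edge_ends xe1 ye1 nxy.
  rewrite !inE (negPf nlx) /= => /eqP ely.
  by move: Us; rewrite /= -ely mem_last.
have [incE0 adjE0] := edge_ends le0 xe0 nlx.
have [incE1 adjE1] := edge_ends xe1 ye1 nxy.
have Lx p : p \in L -> inc x p.1 = false.
  move=> pL; apply: contraNF xs; exact: within_inc (allP wL _ pL).
exists [:: (e0, false), (e1, true) & L]; split.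
- by rewrite /= sL addn0.
- rewrite /= cL andbT; apply/andP; split; last first.
    apply/allP => p pL; apply/andP; split=> /=.
      by apply: contraTneq xe1 => ->; rewrite Lx.
    by apply/implyP; rewrite adjE1 Lx //= => /(hL _ pL)->.
  rewrite {1}/compat /= ne implybT /=.
  apply/allP => p pL; apply/andP; split=> /=.
    by apply: contraTneq xe0 => ->; rewrite Lx.
  apply/implyP; rewrite adjE0 (Lx p) // orbF => /(lL _ pL)->.
  by move: es; case: (odd _).
- rewrite /= !inc_within => [|z|z] /=.
  + by apply: sub_all wL => p; apply: within_sub => z zs; rewrite inE zs orbT.
  + by rewrite incE1 !inE => /orP[]->; rewrite ?orbT.
  + rewrite incE0 [in X in X -> _]inE mem_seq1 => /orP[]/eqP->.
      by rewrite inE mem_last orbT.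
    exact: mem_head.
Qed.

Lemma cover_coloring C : all (valid mult) C -> uniq (vertices C) ->
  exists L : seq (E * bool),
    [/\ size L + count (fun c => ~~ c.1) C = size (vertices C), pairwise compat L
      & all (within (vertices C)) L].
Proof.
elim: C => [|c C IH] /=; first by exists [::].
rewrite /vertices /= cat_uniq => /andP[okc okC] /and3P[Uc dis UC].
have [L [sL cL wL]] := component_coloring okc Uc.
have [M [sM cM wM]] := IH okC UC.
exists (L ++ M); split.
- by rewrite !size_cat -sL -[size (flatten _)]sM; clear; lia.
- rewrite pairwise_cat cL cM !andbT; apply/allrelP => p q pL qM.
  have wp := allP wL _ pL; have wq := allP wM _ qM.
  have npq z : inc z p.1 -> inc z q.1 = false.
    move=> zp; apply: contraNF dis => zq; apply/hasP; exists z.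
      exact: within_inc zq.
    exact: within_inc zp.
  have sp : inc (src p.1) p.1 by rewrite /incident eqxx.
  have tp : inc (tgt p.1) p.1 by rewrite /incident eqxx orbT.
  rewrite /compat /adjacent !npq //= andbT.
  by apply/eqP => e; have := npq _ sp; rewrite -e sp.
- rewrite all_cat; apply/andP; split; [apply: sub_all wL|apply: sub_all wM];
    by move=> p; apply: within_sub => z zs; rewrite mem_cat zs ?orbT.
Qed.

Lemma compat_sym : symmetric compat.
Proof.
move=> p q; rewrite /compat eq_sym (eq_sym p.2); congr (_ && (_ ==> _)).
by rewrite /adjacent /incident !(eq_sym (src q.1)) !(eq_sym (tgt q.1)) orbACA.
Qed.

Lemma coloring_nu L : pairwise compat L -> size L <= nu src tgt 2.
Proof.
move=> cL; have cP p q : p \in L -> q \in L -> p != q -> compat p q.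
  elim: L cL => // r L IH /= /andP[/allP rL cL]; rewrite !inE.
  move=> /orP[/eqP->|pL] /orP[/eqP->|qL]; rewrite ?eqxx // => npq.
  - exact: rL.
  - by rewrite compat_sym rL.
  - exact: IH.
have UL : uniq (map fst L).
  rewrite uniq_pairwise pairwise_map; apply: sub_pairwise cL => p q.
  by case/andP.
have -> : size L = #|[set e | e \in map fst L]|.
  by rewrite cardsE (card_uniqP UL) size_map.
apply: (bigop.leq_bigmax_cond (P := edge_colorable src tgt 2) (F := fun F => #|F|)).
apply/existsP; exists [ffun e => if (e, true) \in L then ord_max else ord0].
have col e b : (e, b) \in L -> ((e, true) \in L) = b.
  case: b => [->//|eL]; apply/negP => eL'.
  have := cP _ _ eL eL'; rewrite xpair_eqE andbF => /(_ isT)/andP[].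
  by rewrite /= eqxx.
apply/forall_inP => e; rewrite inE => /mapP[[e1 b] eL /= ->].
apply/forall_inP => f; rewrite inE => /mapP[[f1 d] fL /= ->].
apply/implyP => /andP[nef aef]; rewrite !ffunE (col _ _ eL) (col _ _ fL).
have /cP := eL => /(_ _ fL); rewrite xpair_eqE (negPf nef) => /(_ isT)/andP[_].
by rewrite /= aef /=; case: b {eL}; case: d {fL}.
Qed.

Lemma nu2_ge : 4 * #|V| <= 5 * nu src tgt 2.
Proof.
(* The cover by isolated vertices shows that covers exist; induction on the cost then reduces to a
   minimal one. *)
suff minC C : is_cover mult C -> 4 * #|V| <= 5 * nu src tgt 2.
  apply: (minC [seq (false, [:: v]) | v <- enum V]); apply/andP; split.
    by apply/allP => c /mapP[v _ ->].
  by rewrite /vertices -map_comp /= flatten_seq1.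
have [n le_n] := ubnP (total_cost C); elim: n C le_n => // n IH C le_n covC.
apply: contraT => nG; have minC C' : is_cover mult C' -> total_cost C <= total_cost C'.
  move=> covC'; rewrite leqNgt; apply/negP => lt.
  by case/negP: nG; apply: IH covC'; apply: leq_trans lt _.
have := minimal_cover_paths mult_sym mult_irrefl mult_degree covC minC.
have /andP[okC pV] := covC.
have [|L [sL cL _]] := cover_coloring okC; first by rewrite (perm_uniq pV) enum_uniq.
have := coloring_nu cL; move: sL nG; rewrite (perm_size pV) -cardE.
rewrite -ltnNge; clear; move: (count _ C) (nu _ _ _) (size L) => p m l <-; lia.
Qed.

(** Each edge of a 3-colored subgraph survives in exactly two of the three subgraphs obtained by
    dropping a color. *)
Lemma nu3_le : 2 * nu src tgt 3 <= 3 * nu src tgt 2.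
Proof.
suff : nu src tgt 3 <= (3 * nu src tgt 2) %/ 2 by rewrite leq_divRL // mulnC.
apply/bigmax_leqP => F /existsP[c /forall_inP cF]; rewrite leq_divRL //.
pose F' i := [set e in F | c e != i].
have F'_le i : #|F' i| <= nu src tgt 2.
  apply: (bigop.leq_bigmax_cond (P := edge_colorable src tgt 2) (F := fun F => #|F|)).
  (* [unlift i] renumbers the two remaining colors; the default only concerns edges of color [i]. *)
  apply/existsP; exists [ffun e => odflt ord0 (unlift i (c e))].
  apply/forall_inP => e; rewrite inE => /andP[eF ei].
  apply/forall_inP => f; rewrite inE => /andP[fF fi].
  have /forall_inP/(_ f fF)/implyP H := cF e eF; apply/implyP => /H.
  rewrite !ffunE eq_sym in ei *; have [j -> ->] := unlift_some ei.
  rewrite eq_sym in fi; have [k -> ->] := unlift_some fi.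
  by rewrite /= (inj_eq lift_inj) eq_sym.
have : \sum_i #|F' i| <= \sum_(i < 3) nu src tgt 2 by apply: leq_sum.
rewrite sum_nat_const card_ord; apply: leq_trans.
under eq_bigr do rewrite -sum1_card big_mkcond /=.
rewrite exchange_big /= -sum1_card big_distrl /= big_mkcond /=.
apply: leq_sum => e _; case: ifP => // eF.
have hF i : (e \in F' i) = (i \in predC1 (c e)) by rewrite !inE eF eq_sym.
by rewrite -big_mkcond /= (eq_bigl _ _ hF) sum1_card cardC1 card_ord.
Qed.

End CubicGraph.

(* nu_2(G) >= 16/17 * (|V| + 2 nu_3(G)) / 4, cleared of denominators:
   16 * (|V| + 2 nu_3) <= 68 * nu_2. *)
Theorem theorem4 (V E : finType) (src tgt : E -> V) :
  loopless src tgt -> cubic src tgt ->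
  16 * (#|V| + 2 * nu src tgt 3) <= 68 * nu src tgt 2.
Proof.
move=> noloop cubicG.
(* Four times the first bound plus sixteen times the second: the coefficient of [n2] is 20 + 48 =
   68. *)
have := nu2_ge noloop cubicG; have := nu3_le src tgt.
move: #|V| (nu _ _ 3) (nu _ _ 2) => n n3 n2; clear; lia.
Qed.
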